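(* Let $A=(a_{ij})$ be an $n\times n$ nonnegative column stochastic matrix, let $y\in\mathbb{R}^n$ be the vector with entries $y_i=\min_{j} a_{ij}$, and let $B$ be a nonnegative column stochastic $n\times n$ matrix such that $\tau_{n-1}(A)\,B=A-y\mathbb{1}^{T}$. (i) If $y$ is not the zero vector and $x$ is a right nonnegative dominant eigenvector of $A$ such that $\mathbb{1}^{T}x=1$, then $I-\tau_{n-1}(A)B$ is nonsingular and $$x=(I-\tau_{n-1}(A)B)^{-1}y.$$ (ii) Conversely, if $I-\tau_{n-1}(A)B$ is invertible, then the vector $y$ is nonzero and $x=(I-\tau_{n-1}(A)B)^{-1}y$ is a right nonnegative dominant eigenvector of $A$ such that $\mathbb{1}^{T}x=1$.
   Context: $\mathbb{1}$ denotes the all-ones column vector of length $n$. A real square matrix $S$ is nonnegative column stochastic if all its entries are nonnegative and $\mathbb{1}^{T}S=\mathbb{1}^{T}$. For such an $n\times n$ matrix $A=(a_{ij})$, define $\tau_{n-1}(A)=1-\sum_{i=1}^n\min_{j=1,\dots,n}a_{ij}$. A right nonnegative dominant eigenvector of a column stochastic matrix $A$ is a nonzero entrywise nonnegative vector $x$ with $Ax=x$ (the spectral radius of $A$ being $1$). *)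

(* Defs.v *)
From HB Require Import structures.
From mathcomp Require Import all_boot all_order all_algebra.
From mathcomp Require Import reals.
Set Implicit Arguments.
Unset Strict Implicit.
Unset Printing Implicit Defensive.

Import Order.TTheory GRing.Theory Num.Theory.
Local Open Scope ring_scope.

Definition ones (R : realType) (n : nat) : 'cV[R]_n := const_mx 1.
Arguments ones : clear implicits.

Definition nonneg_col_stochastic (R : realType) (n : nat) (S : 'M[R]_n) : Prop :=
  (forall i j, 0 <= S i j) /\ (ones R n)^T *m S = (ones R n)^T.

(* The default value A i i is itself one of the entries of row i, so the
   iterated binary minimum is exactly min_j (A i j). *)
Definition row_min (R : realType) (n : nat) (A : 'M[R]_n) (i : 'I_n) : R :=
  \big[Num.min/A i i]_(j < n) A i j.

(* The coefficient written \tau_{n-1}(A). *)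
Definition tau (R : realType) (n : nat) (A : 'M[R]_n) : R :=
  1 - \sum_(i < n) row_min A i.

(* A column stochastic matrix has spectral radius 1, so its dominant
   eigenvectors are those for the eigenvalue 1.  They are right (column)
   eigenvectors, whereas MathComp's eigenspace is about row vectors. *)
Definition right_nonneg_dominant_eigenvector
    (R : realType) (n : nat) (A : 'M[R]_n) (x : 'cV[R]_n) : Prop :=
  [/\ x != 0, forall i, 0 <= x i 0 & A *m x = x].

(* Main.v *)
(* The matrix [M = 1 - tau A *: B] equals [1 - A + y 1^T].  A column stochastic
   [B] is a contraction for the l1 norm, so [(1 - tau A) |z| <= |M z|] in that
   norm.  When [y <> 0] we have [0 <= tau A < 1], and this bound makes [M]
   injective.  It also gives nonnegativity: if [M x = y] then [|x| <= 1], whereas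
   the entries of [x] sum to [1], so [x] coincides with its entrywise absolute
   value. *)

Require Import Defs.
From HB Require Import structures.
From mathcomp Require Import all_boot all_order all_algebra.
From mathcomp Require Import reals.
Set Implicit Arguments.
Unset Strict Implicit.
Unset Printing Implicit Defensive.

Import Order.TTheory GRing.Theory Num.Theory.
Local Open Scope ring_scope.

Lemma ones_trmulE (R : realType) (n m : nat) (z : 'M[R]_(n, m)) (i : 'I_1) (k : 'I_m) :
  ((ones R n)^T *m z) i k = \sum_j z j k.
Proof. by rewrite mxE; apply: eq_bigr => j _; rewrite !mxE mul1r. Qed.

Lemma col_stochastic_sum (R : realType) (n : nat) (S : 'M[R]_n) (k : 'I_n) :
  nonneg_col_stochastic S -> \sum_i S i k = 1.
Proof.
by case=> _ /matrixP/(_ 0 k); rewrite ones_trmulE => ->; rewrite !mxE.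
Qed.

Lemma row_min_le (R : realType) (n : nat) (A : 'M[R]_n) (i j : 'I_n) :
  row_min A i <= A i j.
Proof. exact: bigmin_le_cond. Qed.

Lemma row_min_ge0 (R : realType) (n : nat) (A : 'M[R]_n) (i : 'I_n) :
  nonneg_col_stochastic A -> 0 <= row_min A i.
Proof. by case=> A_ge0 _; apply/bigmin_geP; split. Qed.

Lemma tau_ge0 (R : realType) (n : nat) (A : 'M[R]_n) :
  (0 < n)%N -> nonneg_col_stochastic A -> 0 <= tau A.
Proof.
move=> n_gt0 hA; rewrite subr_ge0 -(col_stochastic_sum (Ordinal n_gt0) hA).
by apply: ler_sum => i _; apply: row_min_le.
Qed.

Lemma tau_le1 (R : realType) (n : nat) (A : 'M[R]_n) :
  nonneg_col_stochastic A -> tau A <= 1.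
Proof.
by move=> hA; rewrite gerBl sumr_ge0 // => i _; apply: row_min_ge0.
Qed.

(** If [tau A] were 1, the row minima, all nonnegative, would sum to 0 and hence all vanish. *)
Lemma tau_lt1 (R : realType) (n : nat) (A : 'M[R]_n) (i : 'I_n) :
  nonneg_col_stochastic A -> row_min A i != 0 -> tau A < 1.
Proof.
move=> hA yi0; rewrite lt_neqAle tau_le1 // andbT.
apply: contra_neq yi0 => /eqP; rewrite -subr_eq0 addrAC subrr add0r oppr_eq0.
by rewrite psumr_eq0 => [/allP/(_ i (mem_index_enum i))/eqP|k _] //; apply: row_min_ge0.
Qed.

(** Triangle inequality applied to [z = (1 - c B) z + c (B z)], the last term having l1 norm at most
    [c |z|]. *)
Lemma l1_stochastic_resolvent (R : realType) (n : nat) (B : 'M[R]_n) (c : R)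
    (z : 'cV[R]_n) :
  nonneg_col_stochastic B -> 0 <= c ->
  (1 - c) * \sum_i `|z i 0| <= \sum_i `|((1%:M - c *: B) *m z) i 0|.
Proof.
move=> hB c_ge0; rewrite mulrBl mul1r lerBlDr.
have le_Bz : \sum_i `|(B *m z) i 0| <= \sum_i `|z i 0|.
  apply: (@le_trans _ _ (\sum_i \sum_j B i j * `|z j 0|)).
    apply: ler_sum => i _; rewrite mxE; apply: le_trans (ler_norm_sum _ _ _) _.
    by apply: ler_sum => j _; rewrite normrM ger0_norm ?hB.1.
  (* Summing over rows first makes the column sums of [B], all equal to 1, appear as
     coefficients. *)
  rewrite exchange_big /=; apply: ler_sum => j _.
  by rewrite -mulr_suml col_stochastic_sum // mul1r.
apply: le_trans (lerD (lexx _) (ler_wpM2l c_ge0 le_Bz)).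
rewrite mulr_sumr -big_split /=; apply: ler_sum => i _.
have -> : z i 0 = ((1%:M - c *: B) *m z) i 0 + c * (B *m z) i 0.
  by rewrite mulmxBl mul1mx -scalemxAl !mxE subrK.
by apply: le_trans (ler_normD _ _) _; rewrite normrM (ger0_norm c_ge0).
Qed.

Lemma unitmx_stochastic_resolvent (R : realType) (n : nat) (B : 'M[R]_n) (c : R) :
  nonneg_col_stochastic B -> 0 <= c < 1 -> 1%:M - c *: B \in unitmx.
Proof.
(* [kermx] is a left kernel, so transposing turns it into the space of columns killed by [1 - c B],
   where the l1 bound applies. *)
move=> hB /andP[c_ge0 c_lt1]; rewrite -unitmx_tr -row_free_unit -kermx_eq0.
apply/rowV0P => v /sub_kermxP vM0.
have Mv0 : (1%:M - c *: B) *m v^T = 0.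
  by rewrite -[RHS]trmx0 -vM0 trmx_mul trmxK.
have := l1_stochastic_resolvent v^T hB c_ge0.
rewrite Mv0 [leRHS]big1 => [|i _]; last by rewrite mxE normr0.
rewrite pmulr_rle0 ?subr_gt0 // => sum_le0.
have /eqP : \sum_i `|v^T i 0| = 0 by apply/eqP; rewrite eq_le sum_le0 sumr_ge0.
rewrite psumr_eq0 // => /allP v0; apply/rowP => i.
by have := v0 i (mem_index_enum i); rewrite !mxE /= normr_eq0 => /eqP.
Qed.

(** The differences [|x k 0| - x k 0] are nonnegative with a sum that is at most 0, so each one
    vanishes. *)
Lemma ge0_of_l1_le_sum (R : realType) (n : nat) (x : 'cV[R]_n) :
  \sum_i `|x i 0| <= \sum_i x i 0 -> forall i, 0 <= x i 0.
Proof.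
move=> le_sum i.
have ge0 k : 0 <= `|x k 0| - x k 0 by rewrite subr_ge0 ler_norm.
have : \sum_k (`|x k 0| - x k 0) == 0.
  by rewrite eq_le sumr_ge0 // andbT sumrB subr_le0.
rewrite psumr_eq0 // => /allP/(_ i (mem_index_enum i)) /=.
by rewrite subr_eq0 => /eqP <-.
Qed.

Theorem theorem3p6 (R : realType) (n : nat) (n_gt0 : (0 < n)%N)
    (A B : 'M[R]_n) (y : 'cV[R]_n)
    (hA : nonneg_col_stochastic A)
    (hy : forall i : 'I_n, y i 0 = row_min A i)
    (hB : nonneg_col_stochastic B)
    (hAB : tau A *: B = A - y *m (ones R n)^T) :
  (y <> 0 ->
   forall x : 'cV[R]_n,
     right_nonneg_dominant_eigenvector A x ->
     (ones R n)^T *m x = 1%:M ->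
     1%:M - tau A *: B \in unitmx /\
     x = invmx (1%:M - tau A *: B) *m y)
  /\
  (1%:M - tau A *: B \in unitmx ->
   y <> 0 /\
   forall x : 'cV[R]_n,
     x = invmx (1%:M - tau A *: B) *m y ->
     right_nonneg_dominant_eigenvector A x /\
     (ones R n)^T *m x = 1%:M).
Proof.
have sum_y : \sum_i y i 0 = 1 - tau A.
  by rewrite /tau subKr; apply: eq_bigr => i _; apply: hy.
have c_ge0 := tau_ge0 n_gt0 hA.
have ones_y : (ones R n)^T *m y = (1 - tau A)%:M.
  by apply/matrixP => i j; rewrite !ord1 ones_trmulE sum_y !mxE mulr1n.
have ones_M : (ones R n)^T *m (1%:M - tau A *: B) = (1 - tau A) *: (ones R n)^T.
  by rewrite mulmxBr mulmx1 -scalemxAr hB.2 [RHS]scalerBl scale1r.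
split=> [/eqP y_neq0 x [_ _ Ax] sum_x|M_unit].
  have /cV0Pn[i yi_neq0] := y_neq0.
  have M_unit : 1%:M - tau A *: B \in unitmx.
    by rewrite unitmx_stochastic_resolvent // c_ge0 (tau_lt1 (i := i)) // -hy.
  split=> //; apply: (canRL (mulKmx M_unit)).
  (* With [A x = x] and [1^T x = 1], [M x = x - (A x - y (1^T x))] collapses to [y]. *)
  by rewrite hAB mulmxBl mul1mx mulmxBl Ax -mulmxA sum_x mulmx1 subKr.
have c_neq1 : 1 - tau A != 0.
  (* If [tau A = 1], then [1^T M = 0]; cancelling the invertible [M] gives [1^T = 0], absurd for
     [n > 0]. *)
  apply/negP => /eqP c1; have := mulmxK M_unit (ones R n)^T.
  rewrite ones_M c1 scale0r mul0mx => /matrixP/(_ 0 (Ordinal n_gt0)).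
  by rewrite !mxE => /eqP; rewrite eq_sym oner_eq0.
have c_lt1 : 0 < 1 - tau A by rewrite lt_def c_neq1 subr_ge0 tau_le1.
split=> [y0|x x_def].
  by move: c_neq1; rewrite -sum_y big1 ?eqxx // => i _; rewrite y0 mxE.
have Mx : (1%:M - tau A *: B) *m x = y by rewrite x_def mulKVmx.
have sum_x : (ones R n)^T *m x = 1%:M.
  (* Applying [1^T] to [M x = y] gives [(1 - tau A) (1^T x) = 1 - tau A]. *)
  apply: (scalerI c_neq1).
  by rewrite scalemxAl -ones_M -mulmxA Mx ones_y scalemx1.
split=> //; split.
- apply/eqP => x0; move/matrixP: sum_x => /(_ 0 0).
  by rewrite x0 mulmx0 !mxE => /eqP; rewrite eq_sym oner_eq0.
- apply: ge0_of_l1_le_sum.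
  have -> : \sum_i x i 0 = 1 by rewrite -(ones_trmulE x 0) sum_x mxE.
  (* Scaled by [1 - tau A], the goal [|x| <= 1] follows from the l1 bound, as [|M x| = |y|] is the
     sum of the entries of [y]. *)
  rewrite -(ler_pM2l c_lt1) mulr1 -[leRHS]sum_y.
  apply: le_trans (l1_stochastic_resolvent x hB c_ge0) _; rewrite Mx.
  by apply: ler_sum => i _; rewrite ger0_norm // hy row_min_ge0.
(* Since [1^T x = 1], [M x = y] reads [x - A x + y = y]. *)
- have := Mx; rewrite hAB mulmxBl mul1mx mulmxBl -mulmxA sum_x mulmx1.
  by rewrite opprB addrCA -[RHS]addr0 => /addrI/subr0_eq.
Qed.
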